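(* Let $k_1,k_2$ be positive integers and let $D$ be a digraph with $\delta^+(D)\geq 2(k_1+k_2)-1$. Then $D$ contains a subdivision of $C(k_1,k_2)$.
   Context: $\delta^+(D)$ is the minimum out-degree. $C(k_1,k_2)$ is the digraph that is the union of two internally disjoint directed paths, one of length $k_1$ and one of length $k_2$, having the same initial vertex and the same terminal vertex. A subdivision of a digraph $F$ is obtained by replacing each arc $(x,y)$ by a directed $(x,y)$-path, these paths being internally disjoint with new internal vertices; ''contains'' means as a subdigraph. *)

(* Defs.v *)
From mathcomp Require Import all_boot.
Set Implicit Arguments. Unset Strict Implicit. Unset Printing Implicit Defensive.

(* A (finite, simple) digraph D is a relation E : rel V on a finType V;
   E x y means there is an arc (x,y). Looplessness is a hypothesis of the
   theorem. Since E is a relation there are no parallel arcs. *)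

Definition outdeg (V : finType) (E : rel V) (x : V) : nat := #|[set y | E x y]|.

Record multidigraph := MultiDigraph {
  mvert : finType;
  marc  : finType;
  mtail : marc -> mvert;
  mhead : marc -> mvert }.

(* Internal vertices of the path  x :: p  (p = the vertices after x). *)
Definition internal (V : eqType) (p : seq V) : seq V := take (size p).-1 p.

(* D contains a subdivision of F (as a subdigraph): the vertices of F are
   mapped injectively to vertices of D (phi), each arc a of F is replaced by
   a directed path phi(tail a) :: P a from phi(tail a) to phi(head a) in D
   (at least one arc, no repeated vertex), the internal vertices of these
   paths are new (not images of vertices of F) and pairwise disjoint for
   distinct arcs, and distinct arcs of F give distinct paths (relevant only
   for parallel arcs of F replaced by a single arc of D). *)
Definition contains_subdivision (V : finType) (E : rel V) (F : multidigraph) : Prop :=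
  exists (phi : mvert F -> V) (P : marc F -> seq V),
    injective phi /\
    (forall a, [/\ P a != [::],
                   path E (phi (mtail a)) (P a),
                   last (phi (mtail a)) (P a) = phi (mhead a) &
                   uniq (phi (mtail a) :: P a)]) /\
    (forall a v, v \in internal (P a) -> forall w, v != phi w) /\
    (forall a b, a != b -> [/\ forall v, v \in internal (P a) -> v \notin internal (P b) &
                              (phi (mtail a), P a) != (phi (mtail b), P b)]).

(* The digraph C(k1,k2), for k1, k2 >= 1, with vertex set {0,...,k1+k2-1}
   and arc set {0,...,k1+k2-1}:
   first path  0 -> 1 -> ... -> k1            (arcs 0..k1-1, length k1),
   second path 0 -> k1+1 -> ... -> k1+k2-1 -> k1 (arcs k1..k1+k2-1, length k2).
   (Vertex/arc type 'I_(k1+k2).-1.+1, which has k1+k2 elements when k1+k2>0.) *)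
Definition C_tail (k1 k2 j : nat) : nat :=
  if j < k1 then j else if j == k1 then 0 else j.
Definition C_head (k1 k2 j : nat) : nat :=
  if j < k1 then j.+1 else if j == (k1 + k2).-1 then k1 else j.+1.

Definition C_digraph (k1 k2 : nat) : multidigraph :=
  @MultiDigraph 'I_(k1 + k2).-1.+1 'I_(k1 + k2).-1.+1
    (fun j => inord (C_tail k1 k2 j)) (fun j => inord (C_head k1 k2 j)).

(* Main.v *)
(* Write k = k1 + k2.  A fork at x consists of two paths of lengths k1 and k2
   that share only their initial vertex x; greedily, a digraph of minimum
   out-degree at least k has a fork at every vertex.  Among all forks preceded
   by a path (the stem) that ends at x and meets the fork only there, take one
   with a longest stem.  Let y1, y2 be the ends of the fork and F the k - 1
   other vertices of it.  If y1 cannot reach the stem in D - F, then the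
   vertices it reaches in D - F have at least (2k - 1) - (k - 1) = k
   out-neighbours among themselves, so there is a fork at y1 inside this set,
   and its stem is longer.  Hence both y1 and y2 reach the last vertex of the
   stem before x in D - F, and paths doing so, cut at the first common vertex,
   complete the fork to the two required paths. *)
Require Import Defs.
From mathcomp Require Import all_boot zify.

Set Implicit Arguments.
Unset Strict Implicit.
Unset Printing Implicit Defensive.

(** Only C(1,1) has two arcs with the same ends, so only there does the distinctness of the paths
    replacing two arcs not follow from their ends. *)
Lemma C_parallel_arcs k1 k2 i j :
    0 < k1 -> 0 < k2 -> i < k1 + k2 -> j < k1 + k2 -> i <> j ->
    C_tail k1 k2 i = C_tail k1 k2 j -> C_head k1 k2 i = C_head k1 k2 j ->
  [/\ k1 = 1, k2 = 1 & i = 0 /\ j = 1 \/ i = 1 /\ j = 0].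
Proof.
rewrite /C_tail /C_head => k1_gt0 k2_gt0 lt_i lt_j ne_ij.
by do 6?[case: ifP => ?]; split; lia.
Qed.

(** * Greedy paths and forks *)

Section PathsAndForks.

Variables (V : finType) (E : rel V).

(** Greedy choice: [A] holds the forbidden vertices, and each step forbids the vertex it leaves
    while [n] drops by one, so the degree bound survives. *)
Lemma path_in_avoiding (Y : {set V}) (A : {set V}) (n : nat) (u : V) :
    irreflexive E -> u \in Y ->
    (forall v, v \in Y -> #|A| + n <= #|[set w in Y | E v w]|) ->
  exists Q, [/\ size Q = n, path E u Q, {subset Q <= Y}, uniq (u :: Q)
              & {in Q, forall v, v \notin A}].
Proof.
move=> irrE; elim: n A u => [|n IHn] A u uY degY; first by exists [::].
have /subsetPn[w] : ~~ ([set w in Y | E u w] \subset A).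
  apply/negP => /subset_leq_card; have := degY u uY; lia.
rewrite inE => /andP[wY Euw] wA.
have [|Q [sQ pQ QY uQ QA]] := IHn (u |: A) w wY.
  by move=> v /degY; rewrite cardsU1; case: (u \in A) => /=; lia.
exists (w :: Q); split=> /=; rewrite ?sQ ?Euw ?pQ //.
- by move=> v; rewrite inE => /predU1P[->|/QY].
- move: uQ => /= ->; rewrite andbT inE negb_or; apply/andP; split.
    by apply: contraTneq Euw => ->; rewrite irrE.
  by apply/negP => /QA; rewrite !inE eqxx.
- move=> v; rewrite inE => /predU1P[->//|/QA].
  by rewrite !inE negb_or => /andP[].
Qed.

(** The second path is grown with the [k1] vertices of the first one after [u] forbidden, whence the
    bound [k1 + k2]. *)
Lemma fork_in (Y : {set V}) (k1 k2 : nat) (u : V) :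
    irreflexive E -> u \in Y ->
    (forall v, v \in Y -> k1 + k2 <= #|[set w in Y | E v w]|) ->
  exists Q1 Q2, [/\ size Q1 = k1 /\ size Q2 = k2, path E u Q1, path E u Q2,
    uniq (u :: Q1 ++ Q2) & {subset Q1 ++ Q2 <= Y}].
Proof.
move=> irrE uY degY.
have [|Q1 [s1 p1 Y1 u1 _]] := @path_in_avoiding Y set0 k1 u irrE uY.
  by move=> v /degY; rewrite cards0; lia.
have [|Q2 [s2 p2 Y2 u2 A2]] := @path_in_avoiding Y [set v in Q1] k2 u irrE uY.
  have cQ1 : #|[set v in Q1]| <= k1 by rewrite cardsE -s1 card_size.
  by move=> v /degY; lia.
exists Q1, Q2; split=> //; last by move=> v; rewrite mem_cat => /orP[/Y1|/Y2].
move: u1 u2; rewrite /= mem_cat cat_uniq negb_or => /andP[-> ->] /andP[-> ->] /=.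
rewrite andbT; apply/hasPn => v /A2; by rewrite inE.
Qed.

(** * Merging two paths at a common vertex *)

Lemma merge_paths (e : rel V) (a b : V) (p q : seq V) :
    path e a p -> uniq (a :: p) -> path e b q -> uniq (b :: q) ->
    last b q \in a :: p ->
  exists p' q', [/\ path e a p' /\ uniq (a :: p'), path e b q' /\ uniq (b :: q'),
    {subset p' <= p} /\ {subset q' <= q}, last a p' = last b q' &
    forall v, v \in a :: p' -> v \in b :: q' -> v = last a p'].
Proof.
(* Walk along [q] until it first meets [a :: p], then cut [p] at that vertex. *)
move=> pp up; elim: q b => [|z q IHq] b pq uq lq.
  move: pp up; case/splitPl: (lq) => p1 p2 lp1.
  rewrite cat_path -cat_cons cat_uniq => /andP[pp1 _] /andP[up1 _].
  exists p1, [::]; split=> //; first by split=> // v; rewrite mem_cat => ->.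
  by move=> v _; rewrite inE lp1 => /eqP.
have [bp|bp] := boolP (b \in a :: p).
  move: pp up; case/splitPl: bp => p1 p2 lp1.
  rewrite cat_path -cat_cons cat_uniq => /andP[pp1 _] /andP[up1 _].
  exists p1, [::]; split=> //; first by split=> // v; rewrite mem_cat => ->.
  by move=> v _; rewrite inE lp1 => /eqP.
move: pq uq => /= /andP[ebz pq] /andP[bq uq].
have [p' [q' [[pp' up'] [pq' uq'] [sp sq] lpq common]]] := IHq z pq uq lq.
exists p', (z :: q'); split=> //.
- split; first by rewrite /= ebz.
  apply/andP; split; last exact: uq'.
  apply: contra bq.
  by rewrite !inE => /predU1P[->|/sq ->]; rewrite ?eqxx ?orbT.
- split=> // v; rewrite !inE => /predU1P[->|/sq ->]; by rewrite ?eqxx ?orbT.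
- move=> v va; rewrite inE => /predU1P[vb|]; last exact: common.
  case/negP: bp; rewrite -vb; move: va; rewrite !inE.
  by case/predU1P => [->|/sp ->]; rewrite ?eqxx ?orbT.
Qed.

Lemma connect_merge (e : rel V) (a b c : V) :
    connect e a c -> connect e b c ->
  exists p q, [/\ path e a p /\ uniq (a :: p), path e b q /\ uniq (b :: q),
    last a p = last b q &
    forall v, v \in a :: p -> v \in b :: q -> v = last a p].
Proof.
case/connectP => p0 /shortenP[p pp up _] -> {p0}.
case/connectP => q0 /shortenP[q pq uq _] lpq {q0}.
have [|p' [q' [? ? _ ? ?]]] := merge_paths pp up pq uq.
  by rewrite -lpq mem_last.
by exists p', q'.
Qed.

(** * Reachability along a path and outside a given list of vertices *)

Lemma connect_last (e : rel V) (a b : V) (p : seq V) :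
  path e a p -> b \in a :: p -> connect e b (last a p).
Proof.
move=> + bp; case/splitPl: bp => p1 p2 lp1.
rewrite cat_path lp1 last_cat lp1 => /andP[_ pp2].
by apply/connectP; exists p2.
Qed.

(** Only the head of an arc is tested, so the start of a path may lie in [F]. *)
Definition avoid (F : seq V) : rel V := [rel a b | E a b && (b \notin F)].

Lemma path_avoid (F : seq V) (a : V) (p : seq V) :
  path (avoid F) a p = path E a p && all [predC F] p.
Proof.
elim: p a => //= b p IHp a.
by rewrite IHp -!andbA; case: (E a b) => //=; case: (b \in F); rewrite ?andbF.
Qed.

Lemma connect_avoid (F : seq V) (a b : V) :
  a \notin F -> connect (avoid F) a b -> b \notin F.
Proof.
move=> aF /connectP[p + ->]; rewrite path_avoid => /andP[_ /allP allF].
by have := mem_last a p; rewrite inE => /predU1P[->|/allF].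
Qed.

Lemma fork_in_reach (k1 k2 : nat) (F : seq V) (y : V) :
    irreflexive E ->
    (forall v, 2 * (k1 + k2) - 1 <= outdeg E v) ->
    size F < k1 + k2 ->
  exists Q1 Q2, [/\ size Q1 = k1 /\ size Q2 = k2, path E y Q1, path E y Q2,
    uniq (y :: Q1 ++ Q2) & {in Q1 ++ Q2, forall v, connect (avoid F) y v}].
Proof.
move=> irrE degE sF.
have [||Q1 [Q2 [? ? ? ? Y]]] := @fork_in [set v | connect (avoid F) y v] k1 k2 y irrE.
- by rewrite inE.
- move=> v; rewrite inE => yv.
  (* An out-neighbour of a reached vertex is reached or lies in [F], so at most [k1 + k2 - 1] of
     them are lost and [k1 + k2] remain. *)
  have sub : [set w | E v w] \subset
      [set w in [set u | connect (avoid F) y u] | E v w] :|: [set w in F].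
    apply/subsetP => w; rewrite !inE => Evw; case wF: (w \in F); rewrite ?orbT //.
    rewrite Evw andbT orbF; apply: connect_trans yv (connect1 _).
    by rewrite /avoid /= Evw wF.
  have := leq_trans (subset_leq_card sub) (leq_card_setU _ _).
  have cF : #|[set w in F]| <= size F by rewrite cardsE card_size.
  have := degE v; rewrite /outdeg; lia.
- by exists Q1, Q2; split=> // v /Y; rewrite inE.
Qed.

(** * Spindles from forks with a stem *)

(** For positive [k1] and [k2] these are the subdivisions of C(k1,k2); [W1 <> W2] then excludes only
    a single arc taken twice. *)
Definition spindle (k1 k2 : nat) (x : V) (W1 W2 : seq V) : Prop :=
  [/\ [/\ k1 <= size W1, path E x W1 & uniq (x :: W1)],
    [/\ k2 <= size W2, path E x W2 & uniq (x :: W2)],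
    last x W1 = last x W2, W1 <> W2 &
    forall v, v \in W1 -> v \in W2 -> v = last x W1].

Definition has_spindle (k1 k2 : nat) : Prop :=
  exists x W1 W2, spindle k1 k2 x W1 W2.

(* The stem is [rcons s x]; the branches of the fork at [x] are split into
   their interiors [T1], [T2] and their ends [y1], [y2]. *)
Definition stemmed_fork (k1 k2 : nat) (s : seq V) (x : V)
    (T1 : seq V) (y1 : V) (T2 : seq V) (y2 : V) : Prop :=
  [/\ sorted E (rcons s x),
      path E x (rcons T1 y1) /\ (size T1).+1 = k1,
      path E x (rcons T2 y2) /\ (size T2).+1 = k2 &
      uniq (s ++ x :: rcons T1 y1 ++ rcons T2 y2)].

Lemma stemmed_fork_sym k1 k2 s x T1 y1 T2 y2 :
  stemmed_fork k1 k2 s x T1 y1 T2 y2 -> stemmed_fork k2 k1 s x T2 y2 T1 y1.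
Proof.
case=> ? ? ? u; split=> //.
rewrite -(perm_uniq (s1 := s ++ x :: rcons T1 y1 ++ rcons T2 y2)) //.
by rewrite perm_cat2l perm_cons perm_catC.
Qed.

Lemma sorted_rcons_cat (s : seq V) (x : V) (p : seq V) :
  sorted E (rcons s x) -> path E x p -> sorted E (s ++ x :: p).
Proof.
case: s => [|a s] //=; rewrite rcons_path cat_path /= => /andP[-> ->] ->.
by [].
Qed.

Lemma reach_stem_or_longer k1 k2 s x T1 y1 T2 y2 :
    irreflexive E ->
    (forall v, 2 * (k1 + k2) - 1 <= outdeg E v) ->
    stemmed_fork k1 k2 s x T1 y1 T2 y2 ->
  (exists2 v, v \in s & connect (avoid (x :: T1 ++ T2)) y1 v) \/
  (exists s' x' T1' y1' T2' y2',
     size s < size s' /\ stemmed_fork k1 k2 s' x' T1' y1' T2' y2').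
Proof.
move=> irrE degE [ss [p1 z1] [p2 z2] u].
(* Leaving [y1] and [y2] out of [F] keeps its size at [k1 + k2 - 1]; the new fork may run through
   [y2]. *)
set F := x :: T1 ++ T2.
have sF : size F < k1 + k2 by rewrite /= size_cat; lia.
have [Q1 [Q2 [[s1 s2] q1 q2 uQ Y]]] := fork_in_reach y1 irrE degE sF.
have [/hasP[v vs yv]|/hasPn noreach] := boolP (has (connect (avoid F) y1) s).
  by left; exists v.
right; case/lastP: Q1 s1 q1 uQ Y => [|T1' y1'] s1 q1 uQ Y; first by move: z1; rewrite -s1.
case/lastP: Q2 s2 q2 uQ Y => [|T2' y2'] s2 q2 uQ Y; first by move: z2; rewrite -s2.
(* The stem absorbs the old branch up to [y1], where the new fork starts. *)
exists (s ++ x :: T1), y1, T1', y1', T2', y2'; split.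
  by rewrite size_cat /=; lia.
have y1F : y1 \notin F.
  move: u; rewrite cat_uniq /= cat_uniq !mem_cat !mem_rcons !inE rcons_uniq.
  case/and4P=> _ _ /norP[/norP[xy _] _] /and3P[/andP[yT1 _] /hasPn dis _].
  rewrite !negb_or eq_sym xy mem_cat negb_or yT1 /=.
  apply: contraTN isT => yT2; have := dis y1.
  by rewrite !mem_rcons !inE yT2 eqxx orbT => /(_ isT).
split=> //.
- by rewrite rcons_cat /=; exact: sorted_rcons_cat.
- by rewrite -s1 size_rcons.
- by rewrite -s2 size_rcons.
- rewrite cat_uniq uQ andbT; apply/andP; split.
    move: u; rewrite -cat_cons catA cat_uniq => /andP[+ _].
    by rewrite -rcons_cons -rcons_cat rcons_uniq => /andP[].
  (* Vertices of the new fork are reached from [y1] outside [F]: they miss [s] by assumption and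
     [x :: T1] as a part of [F]. *)
  apply/hasPn => v vQ; have {vQ} yv : connect (avoid F) y1 v.
    by move: vQ; rewrite inE => /predU1P[->|/Y].
  rewrite mem_cat negb_or; apply/andP; split.
    by apply: contraL yv => /noreach.
  by have := connect_avoid y1F yv; rewrite /F -cat_cons mem_cat => /norP[].
Qed.

(** The paths from [y1] and [y2] to [c] miss the interior of the fork; stopped at their first common
    vertex, they prolong the two branches without a second meeting point. *)
Lemma spindle_of_common_reach k1 k2 s x T1 y1 T2 y2 c :
    stemmed_fork k1 k2 s x T1 y1 T2 y2 ->
    connect (avoid (x :: T1 ++ T2)) y1 c -> connect (avoid (x :: T1 ++ T2)) y2 c ->
  has_spindle k1 k2.
Proof.
move=> [_ [p1 z1] [p2 z2] u] y1c y2c.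
set F := x :: T1 ++ T2 in y1c y2c.
have {u} : uniq (F ++ [:: y1; y2]).
  have perm_F : perm_eq (x :: rcons T1 y1 ++ rcons T2 y2) (F ++ [:: y1; y2]).
    by rewrite /F /= perm_cons -!cats1 (perm_catACA T1 _ T2).
  by rewrite -(perm_uniq perm_F); move: u; rewrite cat_uniq => /and3P[].
rewrite cat_uniq => /and3P[uF /hasPn yF]; rewrite /= inE andbT => y12.
have y1F : y1 \notin F by apply: yF; rewrite !inE eqxx.
have y2F : y2 \notin F by apply: yF; rewrite !inE eqxx orbT.
have [R1 [R2 [[]]]] := connect_merge y1c y2c.
rewrite path_avoid => /andP[r1 /allP a1] u1 [].
rewrite path_avoid => /andP[r2 /allP a2] u2 lR common.
have {a1}a1 v : v \in y1 :: R1 -> v \notin F by rewrite inE => /predU1P[->|/a1].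
have {a2}a2 v : v \in y2 :: R2 -> v \notin F by rewrite inE => /predU1P[->|/a2].
move: (uF); rewrite /F /= mem_cat cat_uniq => /and4P[/norP[xT1 xT2] uT1 /hasPn T12 uT2].
exists x, (T1 ++ y1 :: R1), (T2 ++ y2 :: R2).
rewrite /spindle !last_cat /=; split=> //.
- split; first by rewrite size_cat -z1 addnS ltnS leq_addr.
    by rewrite -cat_rcons cat_path p1 last_rcons.
  rewrite -[_ && _]/(uniq ((x :: T1) ++ y1 :: R1)) cat_uniq u1 cons_uniq xT1 uT1 !andTb andbT.
  apply/hasPn => v /a1.
  by rewrite /F -cat_cons mem_cat => /norP[].
- split; first by rewrite size_cat -z2 addnS ltnS leq_addr.
    by rewrite -cat_rcons cat_path p2 last_rcons.
  rewrite -[_ && _]/(uniq ((x :: T2) ++ y2 :: R2)) cat_uniq u2 cons_uniq xT2 uT2 !andTb andbT.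
  apply/hasPn => v /a2.
  by rewrite /F !inE mem_cat !negb_or => /and3P[-> _ ->].
(* The two paths already differ in their first vertices, which are distinct vertices of the fork. *)
- clear -y12 y1F y2F T12; rewrite {}/F in y1F y2F.
  case: T1 T2 y1F y2F T12 => [|t1 T1] [|t2 T2] y1F y2F T12 [].
  + by move=> ey _; rewrite ey eqxx in y12.
  + by move=> ey _; move: y1F; rewrite ey !inE eqxx orbT.
  + by move=> ey _; move: y2F; rewrite ey !inE eqxx orbT.
  + by move=> et _; move: (T12 t2); rewrite et !inE eqxx => /(_ isT).
- move=> v; rewrite !mem_cat => /orP[v1|v1] /orP[v2|v2].
  + by move: (T12 v v2); rewrite v1.
  + by move: (a2 v v2); rewrite /F inE mem_cat v1 orbT.
  + by move: (a1 v v1); rewrite /F inE mem_cat v2 !orbT.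
  + exact: common.
Qed.

Lemma spindle_of_stemmed_fork k1 k2 s x T1 y1 T2 y2 :
    irreflexive E ->
    (forall v, 2 * (k1 + k2) - 1 <= outdeg E v) ->
    stemmed_fork k1 k2 s x T1 y1 T2 y2 ->
  has_spindle k1 k2.
Proof.
move=> irrE degE.
(* Instead of choosing a longest stem: induction on the number of vertices outside the stem. *)
have [n] := ubnP (#|V| - size s).
elim: n s x T1 y1 T2 y2 => // n IHn s x T1 y1 T2 y2 le_n fk.
have longer s' x' T1' y1' T2' y2' :
    size s < size s' -> stemmed_fork k1 k2 s' x' T1' y1' T2' y2' -> has_spindle k1 k2.
  move=> lt_s fk'; apply: (IHn _ _ _ _ _ _ _ fk').
  case: fk' => _ _ _; rewrite cat_uniq => /andP[/card_uniqP us' _].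
  have := max_card (mem s'); rewrite us'; lia.
have [[v1 v1s c1]|] := reach_stem_or_longer irrE degE fk; last first.
  by move=> [s' [x' [T1' [y1' [T2' [y2' [lt_s fk']]]]]]]; apply: longer lt_s fk'.
have degE' v : 2 * (k2 + k1) - 1 <= outdeg E v by rewrite (addnC k2).
have [[v2 v2s c2]|] := reach_stem_or_longer irrE degE' (stemmed_fork_sym fk); last first.
  move=> [s' [x' [T1' [y1' [T2' [y2' [lt_s fk']]]]]]].
  exact: longer lt_s (stemmed_fork_sym fk').
have {}c2 : connect (avoid (x :: T1 ++ T2)) y2 v2.
  rewrite (eq_connect (e' := avoid (x :: T2 ++ T1))) // => a b.
  by rewrite /avoid /= !inE !mem_cat [(b \in T1) || _]orbC.
case: (fk) => ss _ _ u.
case: s v1s v2s ss u {le_n longer fk} (fk) => // a s v1s v2s ss u fk.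
(* The stem is disjoint from the fork, so it leads from [v1] and from [v2], which may differ, on to
   its last vertex, the common target. *)
have ps : path (avoid (x :: T1 ++ T2)) a s.
  rewrite path_avoid; move: ss; rewrite /= rcons_path => /andP[-> _] /=.
  move: u; rewrite cat_uniq => /and3P[_ /hasPn dis _].
  apply/allP => v vs /=; apply: contraL vs => vF.
  have /dis : v \in x :: rcons T1 y1 ++ rcons T2 y2.
    move: vF; rewrite !inE !mem_cat !mem_rcons !inE.
    by case/or3P=> ->; rewrite ?orbT.
  by rewrite inE => /norP[].
apply: (spindle_of_common_reach (c := last a s) fk).
- exact: connect_trans c1 (connect_last ps v1s).
- exact: connect_trans c2 (connect_last ps v2s).
Qed.

Lemma spindle_exists k1 k2 :
    0 < k1 -> 0 < k2 -> 0 < #|V| -> irreflexive E ->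
    (forall v, 2 * (k1 + k2) - 1 <= outdeg E v) ->
  has_spindle k1 k2.
Proof.
move=> k1_gt0 k2_gt0 /card_gt0P[x _] irrE degE.
have [|Q1 [Q2 [[s1 s2] q1 q2 uQ _]]] := @fork_in_reach k1 k2 [::] x irrE degE.
  by rewrite addn_gt0 k1_gt0.
case/lastP: Q1 s1 q1 uQ => [|T1 y1] s1 q1 uQ; first by rewrite -s1 in k1_gt0.
case/lastP: Q2 s2 q2 uQ => [|T2 y2] s2 q2 uQ; first by rewrite -s2 in k2_gt0.
apply: (@spindle_of_stemmed_fork k1 k2 [::] x T1 y1 T2 y2 irrE degE).
by split; rewrite -?s1 -?s2 ?size_rcons.
Qed.

(** * From spindles to subdivisions of C(k1,k2) *)

Lemma internal_neq_last (a v : V) (p : seq V) :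
  uniq p -> v \in internal p -> v != last a p.
Proof.
case/lastP: p => // p z; rewrite rcons_uniq => /andP[zp _].
rewrite /internal size_rcons -cats1 take_size_cat // last_cat /=.
by apply: contraTneq => ->.
Qed.

(* The pieces into which [x :: W] is cut when it replaces a path with [n]
   arcs: single arcs, except for the last piece, which takes all the rest. *)
Definition piece (x : V) (n : nat) (W : seq V) (i : nat) : seq V :=
  if i.+1 < n then [:: nth x W i] else drop i W.

(** Everything follows from cutting [x :: W] at its vertex number [i], where piece [i] starts.
    Single arcs have no internal vertices, so only the last piece can have any. *)
Lemma pieceP (x : V) (n : nat) (W : seq V) (i : nat) :
    i < n -> n <= size W -> path E x W -> uniq (x :: W) ->
  [/\ piece x n W i != [::], path E (nth x (x :: W) i) (piece x n W i),
      last (nth x (x :: W) i) (piece x n W i) =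
        if i.+1 < n then nth x W i else last x W,
      uniq (nth x (x :: W) i :: piece x n W i) &
      {in internal (piece x n W i), forall v,
        [/\ i.+1 = n, v \in drop n.-1 W & v != last x W]}].
Proof.
move=> lt_in le_nW pW uW.
have lt_iW : i < size W := leq_trans lt_in le_nW.
have split_W : x :: W = take i (x :: W) ++ nth x (x :: W) i :: drop i W.
  rewrite -[drop i W]/(drop i.+1 (x :: W)) -drop_nth ?cat_take_drop //=.
  exact: ltnW.
have drop_iW : drop i W = nth x W i :: drop i.+1 W by rewrite -drop_nth.
have E_piece : path E (nth x (x :: W) i) (drop i W).
  have : sorted E (x :: W) := pW; rewrite {1}split_W.
  by case: (take i _) => [|a p] //=; rewrite cat_path /= => /and3P[].
have u_piece : uniq (nth x (x :: W) i :: drop i W).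
  by move: uW; rewrite {1}split_W cat_uniq => /and3P[].
have l_piece : last (nth x (x :: W) i) (drop i W) = last x W.
  by have := congr1 (last x) split_W; rewrite last_cat.
rewrite /piece; case: ifP => lt_i1n.
  split=> //; move: E_piece u_piece; rewrite drop_iW /=; first by case/andP=> ->.
  by rewrite !inE negb_or => _ /andP[/andP[-> _] _].
have en : i.+1 = n by apply/eqP; rewrite eqn_leq lt_in leqNgt lt_i1n.
split=> //; first by rewrite drop_iW.
move=> v; rewrite -en /= -l_piece => vi; split=> //.
  exact: mem_take vi.
by apply: internal_neq_last vi; case/andP: u_piece.
Qed.

Lemma last_mem_drop (x : V) (n : nat) (W : seq V) :
  0 < n -> n <= size W -> last x W \in drop n.-1 W.
Proof.
move=> n_gt0 le_n; have lt_n1 : n.-1 < size W by rewrite prednK.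
by rewrite -[in last x W](cat_take_drop n.-1 W) last_cat (drop_nth x) //= mem_last.
Qed.

(* The [j]-th item of [L] is the image of the vertex [j] of [C_digraph k1 k2]. *)
Lemma spindle_branch_vertices k1 k2 x W1 W2 :
    0 < k1 -> 0 < k2 -> spindle k1 k2 x W1 W2 ->
  exists L, [/\ uniq L /\ size L = k1 + k2,
    forall i, i < k1 -> nth x L i = nth x (x :: W1) i,
    nth x L k1 = last x W1,
    forall i, 0 < i < k2 -> nth x L (k1 + i) = nth x (x :: W2) i &
    forall v, v != last x W1 ->
      v \in drop k1.-1 W1 \/ v \in drop k2.-1 W2 -> v \notin L].
Proof.
move=> k1_gt0 k2_gt0 [[le1 p1 u1] [le2 p2 u2] lW _ common].
have sA1 : (size (take k1.-1 W1)).+1 = k1 by rewrite size_takel ?prednK //; lia.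
have sA2 : (size (take k2.-1 W2)).+1 = k2 by rewrite size_takel ?prednK //; lia.
have := last_mem_drop x k2_gt0 le2; have := last_mem_drop x k1_gt0 le1.
move: (cat_take_drop k1.-1 W1) (cat_take_drop k2.-1 W2) sA1 sA2 u1 u2 common.
rewrite -lW; move: (last x W1) => y.
move: (take _ W1) (drop _ W1) (take _ W2) (drop _ W2) => A1 B1 A2 B2.
move=> <- <- sA1 sA2.
rewrite /= !cat_uniq !mem_cat !negb_or.
move=> /and4P[/andP[xA1 xB1] uA1 /hasPn AB1 _] /and4P[/andP[xA2 xB2] uA2 /hasPn AB2 _].
move=> common yB1 yB2.
have yA1 : y \notin A1 := AB1 y yB1.
have yA2 : y \notin A2 := AB2 y yB2.
(* The order is the numbering of C(k1,k2): [x] is 0, [A1] fills the places up to [k1 - 1], the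
   common end [y] is [k1], and [A2] follows. *)
exists ((x :: A1) ++ y :: A2); split.
- split; last by rewrite size_cat -sA1 -sA2.
  rewrite cat_uniq !cons_uniq xA1 uA1 yA2 uA2 !andbT andTb; apply/hasPn => v.
  rewrite !inE negb_or => /predU1P[->|v2].
    by rewrite yA1 andbT; apply: contraNneq xB1 => <-.
  apply/andP; split; first by apply: contraNneq xA2 => <-.
  by apply: contra yA2 => v1; rewrite -(common v) // mem_cat ?v1 ?v2.
- by move=> i lt_i; rewrite -cat_cons !nth_cat /= sA1 lt_i.
- by rewrite nth_cat /= sA1 ltnn subnn.
- case=> // i /andP[_ lt_i]; rewrite nth_cat [size _]/= sA1 ltnNge leq_addr addKn /=.
  by rewrite nth_cat -ltnS sA2 lt_i.
- move=> v vy; rewrite mem_cat !inE !negb_or vy; case=> vB.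
    rewrite (AB1 v vB) !andbT; apply/andP; split.
      by apply: contraNneq xB1 => <-.
    by apply: contra vy => vA; rewrite (common v) ?mem_cat ?vB ?vA ?orbT.
  rewrite (AB2 v vB) !andbT; apply/andP; split.
    by apply: contraNneq xB2 => <-.
  by apply: contra vy => vA; rewrite (common v) ?mem_cat ?vB ?vA ?orbT.
Qed.

Lemma spindle_subdivision k1 k2 :
  0 < k1 -> 0 < k2 -> has_spindle k1 k2 -> contains_subdivision E (C_digraph k1 k2).
Proof.
move=> k1_gt0 k2_gt0 [x [W1 [W2 sp]]].
have [L [[uL sL] L1 Ly L2 L_out]] := spindle_branch_vertices k1_gt0 k2_gt0 sp.
case: sp => -[le1 p1 u1] [le2 p2 u2] lW nW common.
have kE : (k1 + k2).-1.+1 = k1 + k2 by rewrite prednK // addn_gt0 k1_gt0.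
have {}sL : size L = (k1 + k2).-1.+1 by rewrite kE.
have ltI (a : 'I_(k1 + k2).-1.+1) : a < k1 + k2.
  exact: leq_trans (ltn_ord a) (eq_leq kE).
have tail_lt j : j < k1 + k2 -> C_tail k1 k2 j < (k1 + k2).-1.+1.
  by rewrite /C_tail; do 2?[case: ifP => ?]; lia.
have head_lt j : j < k1 + k2 -> C_head k1 k2 j < (k1 + k2).-1.+1.
  by rewrite /C_head; do 2?[case: ifP => ?]; lia.
(* An arc [j] with [k1 <= j] is arc number [j - k1] of the second path. *)
have tailE j : j < k1 + k2 -> nth x L (C_tail k1 k2 j) =
    if j < k1 then nth x (x :: W1) j else nth x (x :: W2) (j - k1).
  move=> lt_j; rewrite /C_tail; case: ifP => [/L1 //|ge_j].
  case: eqP => [->|ne_j]; first by rewrite subnn L1.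
  by rewrite -L2; [congr nth; lia | lia].
have headE j : j < k1 + k2 -> nth x L (C_head k1 k2 j) =
    if j < k1 then if j.+1 < k1 then nth x W1 j else last x W1
    else if (j - k1).+1 < k2 then nth x W2 (j - k1) else last x W2.
  move=> lt_j; rewrite /C_head -lW; case: ifP => [lt_j1|ge_j].
    by case: ifP => [/L1 //|ge_j1]; have -> : j.+1 = k1 by lia.
  case: eqP => [ej|ne_j]; first by rewrite ifF //; lia.
  rewrite ifT; last by lia.
  have -> : j.+1 = k1 + (j - k1).+1 by lia.
  by rewrite L2 //; lia.
have [P PE] : exists P : 'I_(k1 + k2).-1.+1 -> seq V, forall a, P a =
    if a < k1 then piece x k1 W1 a else piece x k2 W2 (a - k1).
  by exists (fun a => if a < k1 then piece x k1 W1 a else piece x k2 W2 (a - k1)).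
have PP (a : 'I_(k1 + k2).-1.+1) : [/\ P a != [::],
    path E (nth x L (C_tail k1 k2 a)) (P a),
    last (nth x L (C_tail k1 k2 a)) (P a) = nth x L (C_head k1 k2 a),
    uniq (nth x L (C_tail k1 k2 a) :: P a) &
    {in internal (P a), forall v, v != last x W1 /\
       ([/\ a < k1, a.+1 = k1 & v \in drop k1.-1 W1] \/
        [/\ k1 <= a, a.+1 = k1 + k2 & v \in drop k2.-1 W2])}].
  have lt_a := ltI a; rewrite tailE // headE // PE; case: ltnP => a_k1.
    have [? ? ? ? int] := pieceP a_k1 le1 p1 u1.
    by split=> // v /int[? ? ?]; split=> //; left.
  have lt_a2 : a - k1 < k2 by lia.
  have [? ? ? ? int] := pieceP lt_a2 le2 p2 u2.
  split=> // v /int[en ? ?]; rewrite lW; split=> //; right; split=> //.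
  by move: (congr1 (addn k1) en); rewrite addnS subnKC.
have phi_inj : injective (fun i : 'I_(k1 + k2).-1.+1 => nth x L i).
  move=> i j /eqP; rewrite nth_uniq ?sL ?ltn_ord // => /eqP eq_ij.
  exact: val_inj.
exists (fun i : 'I_(k1 + k2).-1.+1 => nth x L i), P.
split; [exact: phi_inj | split; [|split]].
- move=> a; rewrite /= !inordK ?tail_lt ?head_lt ?ltI //.
  by have [] := PP a.
- move=> a v va w; have [_ _ _ _ /(_ v va)[v_last int]] := PP a.
  have /(L_out v v_last) vL : v \in drop k1.-1 W1 \/ v \in drop k2.-1 W2.
    by case: int => -[]; [left | right].
  by apply: contraNneq vL => ->; rewrite mem_nth // sL.
- move=> a b /eqP ne_ab; split.
    (* A shared internal vertex forces both arcs to be last on their paths; if these paths differ,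
       it lies on [W1] and [W2] and so is their common end, which is not internal. *)
    move=> v va; apply/negP => vb; apply: ne_ab; apply/val_inj => /=.
    have [_ _ _ _ /(_ v va)[/eqP v_last inta]] := PP a.
    have [_ _ _ _ /(_ v vb)[_ intb]] := PP b.
    case: inta intb => -[_ ea va'] [] [_ eb vb'].
    + by apply: succn_inj; rewrite ea eb.
    + by case: v_last; apply: common; [exact: mem_drop va' | exact: mem_drop vb'].
    + by case: v_last; apply: common; [exact: mem_drop vb' | exact: mem_drop va'].
    + by apply: succn_inj; rewrite ea eb.
  (* Equal paths with equal starts make the arcs parallel, so [k1 = k2 = 1]; the two pieces are then
     all of [W1] and [W2], which differ. *)
  apply/negP => /eqP[/phi_inj /(congr1 val) /=].
  rewrite !inordK ?tail_lt ?ltI // => eq_tail eq_P.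
  have eq_head : C_head k1 k2 a = C_head k1 k2 b.
    have [_ _ la _ _] := PP a; have [_ _ lb _ _] := PP b.
    move: lb; rewrite -eq_tail -eq_P la => /eqP.
    by rewrite nth_uniq ?sL ?head_lt ?ltI // => /eqP.
  have [ek1 ek2 [[ea eb]|[ea eb]]] :=
    C_parallel_arcs k1_gt0 k2_gt0 (ltI a) (ltI b)
      (contra_not (@val_inj _ _ _ a b) ne_ab) eq_tail eq_head.
    by apply: nW; move: eq_P; rewrite !PE ea eb ek1 ek2 /piece /= !drop0.
  by apply: nW; move: eq_P; rewrite !PE ea eb ek1 ek2 /piece /= !drop0.
Qed.

End PathsAndForks.

Theorem theorem24 (k1 k2 : nat) (V : finType) (E : rel V) :
  0 < k1 -> 0 < k2 ->
  0 < #|V| ->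
  irreflexive E ->
  (forall x : V, 2 * (k1 + k2) - 1 <= outdeg E x) ->
  contains_subdivision E (C_digraph k1 k2).
Proof.
move=> k1_gt0 k2_gt0 V_gt0 irrE degE.
exact/spindle_subdivision/spindle_exists.
Qed.
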